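(* Let $\alpha$ be a positive root. Given a generalized complex structure $\mathbb J_\alpha$ on $\mathfrak u_\alpha$ of noncomplex type, there exists a $B$-transformation $B_\alpha\in\bigwedge^2\mathfrak u_\alpha^\ast$ such that $$e^{-B_\alpha}\,\mathbb J_{\omega_\alpha}\,e^{B_\alpha}=\mathbb J_\alpha,$$ where $\mathbb J_{\omega_\alpha}$ is the generalized complex structure of symplectic type induced by $\mathbb J_\alpha$.
   Context: Let $\mathfrak g$ be a complex semisimple Lie algebra with Cartan subalgebra $\mathfrak h$, positive roots $\Pi^+$, Cartan–Killing form $\langle\cdot,\cdot\rangle$, $H_\alpha\in\mathfrak h$ with $\alpha=\langle H_\alpha,\cdot\rangle$, and Weyl basis $X_\alpha\in\mathfrak g_\alpha$ ($\langle X_\alpha,X_{-\alpha}\rangle=1$). For $\alpha\in\Pi^+$ put $A_\alpha=X_\alpha-X_{-\alpha}$, $S_\alpha=i(X_\alpha+X_{-\alpha})$ and $\mathfrak u_\alpha=\mathrm{span}_{\mathbb R}\{A_\alpha,S_\alpha\}$. Let $H$ be a fixed regular element of $\mathfrak t=i\,\mathrm{span}_{\mathbb R}\{H_\alpha\}$, $\omega_{b_0}(X,Y)=\langle H,[X,Y]\rangle$, $k_\alpha=\frac{1}{2i\langle H,H_\alpha\rangle}$, and $X^\ast=k_\alpha\omega_{b_0}(X,\cdot)\in\mathfrak u_\alpha^\ast$ for $X\in\mathfrak u_\alpha$; then $(-S_\alpha^\ast,A_\alpha^\ast)$ is the basis of $\mathfrak u_\alpha^\ast$ dual to $(A_\alpha,S_\alpha)$.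 A (torus-invariant) generalized complex structure of noncomplex type on $\mathfrak u_\alpha$ is an endomorphism $\mathbb J_\alpha$ of $\mathfrak u_\alpha\oplus\mathfrak u_\alpha^\ast$ whose matrix in the basis $(A_\alpha,S_\alpha,-S_\alpha^\ast,A_\alpha^\ast)$ is $$\begin{pmatrix}a_\alpha&0&0&-x_\alpha\\ 0&a_\alpha&x_\alpha&0\\ 0&-y_\alpha&-a_\alpha&0\\ y_\alpha&0&0&-a_\alpha\end{pmatrix},\qquad a_\alpha,x_\alpha,y_\alpha\in\mathbb R,\ a_\alpha^2=x_\alpha y_\alpha-1.$$ The structure of symplectic type induced by it is $$\mathbb J_{\omega_\alpha}=\begin{pmatrix}0&0&0&-x_\alpha\\ 0&0&x_\alpha&0\\ 0&-1/x_\alpha&0&0\\ 1/x_\alpha&0&0&0\end{pmatrix}.$$ For $B\in\bigwedge^2\mathfrak u_\alpha^\ast$, $e^B(X+\xi)=X+\xi+i_XB$. *)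

(* Defs.v *)
From HB Require Import structures.
From mathcomp Require Import all_boot all_order all_algebra.
From mathcomp Require Import reals.
From mathcomp Require Import complex.

Set Implicit Arguments.
Unset Strict Implicit.
Unset Printing Implicit Defensive.

Import GRing.Theory.

Local Open Scope ring_scope.

HB.mixin Record isLieAlgebra (K : fieldType) g of Vector K g := {
  lie : g -> g -> g;
  lie_linearl : forall y, linear (fun x => lie x y);
  lie_linearr : forall x, linear (lie x);
  liexx : forall x, lie x x = 0;
  lie_jacobi : forall x y z,
    lie x (lie y z) + lie y (lie z x) + lie z (lie x y) = 0
}.

#[short(type="lieAlgType")]
HB.structure Definition LieAlgebra (K : fieldType) :=
  { g of isLieAlgebra K g & Vector K g }.

Section LieTheory.
Variables (K : fieldType) (g : lieAlgType K).

HB.instance Definition _ (x : g) :=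
  GRing.isLinear.Build K g g *:%R (lie x) (lie_linearr x).

Definition ad (x : g) : 'End(g) := linfun (lie x).

Definition lfun_trace (f : 'End(g)) : K :=
  \tr (passmx.mxof (vbasis {:g}) (vbasis {:g}) f).

Definition killing (x y : g) : K := lfun_trace (ad x \o ad y)%VF.

(* [U, V], the linear span of the brackets [u, v]; by bilinearity it is enough
   to let u and v range over bases. *)
Definition lieprod (U V : {vspace g}) : {vspace g} :=
  <<[seq lie u v | u <- vbasis U, v <- vbasis V]>>%VS.

Definition derived_series (U : {vspace g}) (n : nat) : {vspace g} :=
  iter n (fun V => lieprod V V) U.

Definition lower_central_series (U : {vspace g}) (n : nat) : {vspace g} :=
  iter n (lieprod U) U.

Definition lie_solvable (U : {vspace g}) : Prop :=
  exists n, derived_series U n = 0%VS.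

Definition lie_nilpotent (U : {vspace g}) : Prop :=
  exists n, lower_central_series U n = 0%VS.

Definition lie_subalgebra (U : {vspace g}) : Prop :=
  forall x y, x \in U -> y \in U -> lie x y \in U.

Definition lie_ideal (U : {vspace g}) : Prop :=
  forall x y, y \in U -> lie x y \in U.

(* The radical, i.e. the largest solvable ideal, is zero. *)
Definition semisimple : Prop :=
  forall U : {vspace g}, lie_ideal U -> lie_solvable U -> U = 0%VS.

Definition cartan_subalgebra (h : {vspace g}) : Prop :=
  [/\ lie_subalgebra h, lie_nilpotent h &
      forall x, (forall y, y \in h -> lie x y \in h) -> x \in h].

End LieTheory.

Arguments semisimple {K} g.

Section Roots.
Variables (K : fieldType) (g : lieAlgType K) (h : {vspace g}).

Definition hdual := 'Hom(subvs_of h, K^o).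
Implicit Types (a b : hdual).

Definition in_root_space a (x : g) : Prop :=
  forall Y : subvs_of h, lie (vsval Y) x = (a Y : K) *: x.

Definition is_root a : Prop :=
  a <> 0 /\ exists2 x : g, x <> 0 & in_root_space a x.

Definition positive_system (P : hdual -> Prop) : Prop :=
  [/\ forall a, P a -> is_root a,
      forall a, is_root a -> P a \/ P (- a),
      forall a, ~ (P a /\ P (- a)) &
      forall a b, P a -> P b -> is_root (a + b) -> P (a + b)].

(* Hr assigns to every root a the vector H_a of h with a = <H_a, .>. *)
Definition root_vectors (Hr : hdual -> subvs_of h) : Prop :=
  forall a, is_root a ->
  forall Y : subvs_of h, a Y = killing (vsval (Hr a)) (vsval Y) :> K.

Definition regular (H : subvs_of h) : Prop :=
  forall a, is_root a -> a H <> 0.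

End Roots.

Section Weyl.
Variables (R : realType) (g : lieAlgType R[i]) (h : {vspace g}).
Local Notation hd := (hdual h).
Local Open Scope complex_scope.

(* The structure constants m a b are real. The values of X away from the roots
   are irrelevant. *)
Definition weyl_basis (X : hd -> g) : Prop :=
  [/\ forall a, is_root a -> in_root_space a (X a),
      forall a, is_root a -> killing (X a) (X (- a)) = 1 &
      exists m : hd -> hd -> R,
        [/\ forall a b, is_root a -> is_root b -> is_root (a + b) ->
              lie (X a) (X b) = (m a b)%:C *: X (a + b),
            forall a b, is_root a -> is_root b -> a + b <> 0 ->
              ~ is_root (a + b) -> lie (X a) (X b) = 0 &
            forall a b, is_root a -> is_root b -> is_root (a + b) ->
              m (- a) (- b) = - m a b]].

(* H lies in t = i span_R {H_a | a a root}. *)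
Definition in_torus (Hr : hd -> subvs_of h) (H : subvs_of h) : Prop :=
  exists (s : seq hd) (c : hd -> R),
    (forall a, a \in s -> is_root a) /\
    H = 'i *: \sum_(a <- s) (c a)%:C *: Hr a.

End Weyl.

(* The real vector space underlying a complex vector space. *)
Definition realification (R : realType) (V : vectType R[i]) : Type := V.

Section Realification.
Variables (R : realType) (V : vectType R[i]).
Local Notation VR := (realification V).
Local Open Scope complex_scope.

HB.instance Definition _ := GRing.Zmodule.on VR.

Definition real_scale (r : R) (v : VR) : VR := (r%:C *: (v : V))%R.

Fact real_scaleA (a b : R) (v : VR) :
  real_scale a (real_scale b v) = real_scale (a * b) v.
Proof. by rewrite /real_scale scalerA -rmorphM. Qed.

Fact real_scale1 : left_id 1 real_scale.
Proof. by move=> v; rewrite /real_scale rmorph1 scale1r. Qed.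

Fact real_scaleDr : right_distributive real_scale +%R.
Proof. by move=> a u v; apply: (@scalerDr R[i] V). Qed.

Fact real_scaleDl (v : VR) : {morph real_scale^~ v : a b / a + b}.
Proof. by move=> a b; rewrite /real_scale rmorphD; apply: (@scalerDl R[i] V). Qed.

HB.instance Definition _ := GRing.Zmodule_isLmodule.Build R VR
  real_scaleA real_scale1 real_scaleDr real_scaleDl.

Fact realification_vect_axiom :
  Vector.axiom (\dim {:V} + \dim {:V}) VR.
Proof.
pose e := vbasis {:V}; have eb : basis_of {:V} e := vbasisP _.
pose f (v : VR) : 'rV[R]_(\dim {:V} + \dim {:V}) :=
  row_mx (map_mx (@complex.Re R) (passmx.rVof e v)) (map_mx (@complex.Im R) (passmx.rVof e v)).
exists f.
  move=> r u v; rewrite /f.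
  have -> : passmx.rVof e (r *: u + v : VR) =
            r%:C *: passmx.rVof e u + passmx.rVof e v
    by exact: (passmx.rVof_linear e).
  rewrite scale_row_mx add_row_mx; congr row_mx; apply/rowP=> i; rewrite !mxE.
    by case: (coord _ _ u) (coord _ _ v) => [a b] [c d] /=; rewrite mul0r subr0.
  by case: (coord _ _ u) (coord _ _ v) => [a b] [c d] /=; rewrite mul0r addr0.
exists (fun w : 'rV[R]_(\dim {:V} + \dim {:V}) =>
  passmx.vecof e (\row_i (Complex (lsubmx w 0 i) (rsubmx w 0 i))) : VR).
  move=> v; rewrite /f row_mxKl row_mxKr -[RHS](passmx.rVofK eb).
  by congr passmx.vecof; apply/rowP=> i; rewrite !mxE; case: (coord _ _ _).
move=> w; rewrite /f passmx.vecofK // -[RHS]hsubmxK.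
by congr row_mx; apply/rowP=> i; rewrite !mxE.
Qed.

HB.instance Definition _ :=
  Lmodule_hasFinDim.Build R VR realification_vect_axiom.

End Realification.

Section GeneralizedTangent.
Variables (R : realType) (u : vectType R).

Definition dual := 'Hom(u, R^o).

Local Notation gtangent := (u * dual)%type.

(* The matrix M acts on column vectors of coordinates: the endomorphism sends
   e_j to \sum_i M i j *: e_i. *)
Definition has_matrix (n : nat) (V : vectType R) (e : n.-tuple V)
    (J : 'End(V)) (M : 'M[R]_n) : Prop :=
  forall j, J (tnth e j) = \sum_i M i j *: tnth e i.

Definition endo_of_matrix (n : nat) (V : vectType R) (e : n.-tuple V)
    (M : 'M[R]_n) : 'End(V) :=
  linfun (fun v => \sum_i (\sum_j M i j * coord e j v) *: tnth e i).

(* Elements of \bigwedge^2 u^*: alternating bilinear forms B on u, encoded as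
   X |-> i_X B = B(X, .). *)
Definition alternating (B : 'Hom(u, dual)) : Prop :=
  forall X : u, (B X : dual) X = 0.

Definition exp_form (B : 'Hom(u, dual)) : 'End(gtangent) :=
  linfun (fun v : gtangent => (v.1, v.2 + B v.1)).

End GeneralizedTangent.

Definition noncomplex_mx (R : realType) (a x y : R) : 'M[R]_4 :=
  \matrix_(i, j) nth 0 (nth [::]
    [:: [:: a; 0; 0; - x];
        [:: 0; a; x; 0];
        [:: 0; - y; - a; 0];
        [:: y; 0; 0; - a]] i) j.

Definition symplectic_mx (R : realType) (x : R) : 'M[R]_4 :=
  \matrix_(i, j) nth 0 (nth [::]
    [:: [:: 0; 0; 0; - x];
        [:: 0; 0; x; 0];
        [:: 0; - (1 / x); 0; 0];
        [:: 1 / x; 0; 0; 0]] i) j.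

Section RootPlane.
Variables (R : realType) (g : lieAlgType R[i]) (h : {vspace g}).
Variables (Hr : hdual h -> subvs_of h) (X : hdual h -> g).
Variables (H : subvs_of h) (alpha : hdual h).
Local Notation gR := (realification g).
Local Open Scope complex_scope.

Definition A_vec : g := X alpha - X (- alpha).
Definition S_vec : g := 'i *: (X alpha + X (- alpha)).

Definition root_plane : {vspace gR} := <<[:: A_vec : gR; S_vec : gR]>>%VS.
Definition u_alpha := subvs_of root_plane.

Definition A_alpha : u_alpha := vsproj root_plane (A_vec : gR).
Definition S_alpha : u_alpha := vsproj root_plane (S_vec : gR).

Definition omega (Y Z : g) : R[i] := killing (vsval H) (lie Y Z).

Definition k_alpha : R[i] := 1 / (2%:R * 'i * killing (vsval H) (vsval (Hr alpha))).

(* X^* = k_alpha omega(X, .) as a real functional on u_alpha; for H in t its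
   values on u_alpha are already real, so Re only changes their type. *)
Definition star (Y : u_alpha) : dual u_alpha :=
  linfun (fun Z : u_alpha => complex.Re (k_alpha * omega (vsval Y) (vsval Z)) : R^o).

Definition plane_basis : 4.-tuple (u_alpha * dual u_alpha)%type :=
  [tuple (A_alpha, 0); (S_alpha, 0); (0, - star S_alpha); (0, star A_alpha)].

Definition noncomplex_type (a x y : R) (J : 'End((u_alpha * dual u_alpha)%type)) : Prop :=
  a ^+ 2 = x * y - 1 /\ has_matrix plane_basis J (noncomplex_mx a x y).

(* The structure of symplectic type induced by a structure of noncomplex type
   with parameters a, x, y; it depends on x only. *)
Definition symplectic_type (x : R) : 'End((u_alpha * dual u_alpha)%type) :=
  endo_of_matrix plane_basis (symplectic_mx x).

End RootPlane.

(* Main.v *)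
Require Import Defs.
From HB Require Import structures.
From mathcomp Require Import all_boot all_order all_algebra.
From mathcomp Require Import reals.
From mathcomp Require Import complex.
From mathcomp Require Import ring.

Set Implicit Arguments.
Unset Strict Implicit.
Unset Printing Implicit Defensive.

Import GRing.Theory Num.Theory.
Local Open Scope ring_scope.

(** Everything reduces to linear algebra in a plane carrying a basis (e, f) and
    its dual basis (phi, psi).  An alternating form on the plane is a multiple
    c (phi /\ psi), and its exponential maps e to e + c psi, f to f - c phi and
    fixes phi and psi.  Conjugating the symplectic structure with parameter x,
    which sends e to psi / x and psi to - x e, gives
        e |-> - c x e + (1 / x + c^2 x) psi,   psi |-> - x e + c x psi,
    and likewise on f and phi.  Matching the diagonal entry a forces
    c = - a / x, and then the off-diagonal entry is (1 + a^2) / x, which is y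
    because a^2 = x y - 1.  The same relation gives x y = 1 + a^2 > 0, so x is nonzero.
    This computation is [noncomplex_B_transform].

    What the Lie theory must supply is that the plane of the root alpha, with
    (A, S) and (- S^*, A^* ), really is such a dual pair: without this the given
    four vectors would not determine endomorphisms.  The pairing is alternating
    because the bracket is, so only A^*(S) = 1 has to be computed.  As
    [A, S] = 2 i [X_alpha, X_{- alpha}], invariance of the Killing form gives
    <H, [A, S]> = 2 i <[H, X_alpha], X_{- alpha}> = 2 i alpha(H), which is
    1 / k_alpha and does not vanish since H is regular ([star_A_S]).  Linear
    independence of A and S over the reals, and of their duals, then follows
    from the values of the pairing. *)

(** * The Killing form *)

Lemma linfunE (K : nzRingType) (U V : vectType K) (f : U -> V) :
  linear f -> linfun f =1 f.
Proof.
move=> f_lin v.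
pose F := GRing.isLinear.Build K U V *:%R f f_lin.
exact: (lfunE (HB.pack_for {linear U -> V} f F) v).
Qed.

Section LieTheory.
Variables (K : fieldType) (g : lieAlgType K).
Implicit Types (u v w : g) (p q : 'End(g)).

Lemma adE u v : ad u v = lie u v.
Proof. exact: linfunE (@lie_linearr K g u) v. Qed.

Lemma ad_linear : linear (@ad K g).
Proof.
move=> k u v; apply/lfunP=> w.
by rewrite add_lfunE scale_lfunE !adE lie_linearl.
Qed.

Lemma lieBl u v w : lie (u - v) w = lie u w - lie v w :> g.
Proof. by rewrite -[u - v]addrC -scaleN1r lie_linearl scaleN1r addrC. Qed.

Lemma lie_anticomm u v : lie v u = - lie u v.
Proof.
have := liexx (u - v); rewrite lieBl !linearB /= !liexx !oppr0 addr0 add0r.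
by move/eqP; rewrite -opprD oppr_eq0 addrC addr_eq0 => /eqP.
Qed.

(** The Jacobi identity, read as: ad is a representation. *)
Lemma ad_lie u v : ad (lie u v) = (ad u \o ad v)%VF - (ad v \o ad u)%VF.
Proof.
apply/lfunP=> w; rewrite add_lfunE opp_lfunE !comp_lfunE !adE.
have := lie_jacobi u v w.
rewrite (lie_anticomm u w) linearN /= (lie_anticomm (lie u v) w) => /eqP.
by rewrite subr_eq0 => /eqP <-.
Qed.

Lemma lfun_trace_linear : linear (@lfun_trace K g : 'End(g) -> K^o).
Proof.
by move=> k p q; rewrite /lfun_trace passmx.mxof_linear mxtraceD mxtraceZ.
Qed.

Lemma lfun_traceC p q : lfun_trace (p \o q)%VF = lfun_trace (q \o p)%VF.
Proof.
by rewrite /lfun_trace !(passmx.mxof_comp _ _ (vbasisP _)) mxtrace_mulC.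
Qed.

Lemma lfun_traceB p q : lfun_trace (p - q) = lfun_trace p - lfun_trace q.
Proof.
by rewrite addrC -scaleN1r lfun_trace_linear /GRing.scale /= mulN1r addrC.
Qed.

Lemma killingC u v : killing u v = killing v u.
Proof. exact: lfun_traceC. Qed.

Lemma killing_linear u : linear (killing u : g -> K^o).
Proof.
move=> k v w.
by rewrite /killing ad_linear comp_lfunDr -comp_lfunZr lfun_trace_linear.
Qed.

HB.instance Definition _ u :=
  GRing.isLinear.Build K g K^o *:%R (killing u) (killing_linear u).

(** Invariance: after expanding both brackets into commutators of ad, the first
    terms agree and the second ones differ by a cyclic permutation under the
    trace. *)
Lemma killing_lieA u v w : killing (lie u v) w = killing u (lie v w).
Proof.
rewrite /killing !ad_lie comp_lfunDl comp_lfunDr comp_lfunNl comp_lfunNr.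
rewrite !lfun_traceB -!comp_lfunA.
by congr (_ - _); rewrite lfun_traceC comp_lfunA.
Qed.

End LieTheory.

(** * B-transformations of a plane with a dual pair of bases *)

Lemma exp_formE (R : realType) (u : vectType R) (B : 'Hom(u, dual u))
    (v : u * dual u) :
  exp_form B v = (v.1, v.2 + B v.1).
Proof.
apply: linfunE => k [v1 v2] [w1 w2] /=; rewrite linearP.
by congr pair; rewrite /= scalerDr addrACA.
Qed.

(** Freeness is essential: [endo_of_matrix] reads coordinates with [coord],
    which picks out the coefficients of the family only when it is free. *)
Lemma endo_of_matrixP (R : realType) (V : vectType R) (n : nat)
    (e : n.-tuple V) (M : 'M[R]_n) :
  free e -> has_matrix e (endo_of_matrix e M) M.
Proof.
move=> e_free j; rewrite linfunE; last first.
  move=> k v w; rewrite scaler_sumr -big_split; apply: eq_bigr => i _ /=.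
  rewrite scalerA -scalerDl mulr_sumr -big_split /=; congr (_ *: _).
  by apply: eq_bigr => l _; rewrite linearP mulrDr /= mulrCA.
apply: eq_bigr => i _; congr (_ *: _); rewrite (bigD1 j) //= big1 => [|l lj].
  by rewrite (tnth_nth 0) coord_free // eqxx mulr1 addr0.
by rewrite (tnth_nth 0) coord_free // eq_sym (negbTE lj) mulr0.
Qed.

Section DualPair.
Variables (R : realType) (u : vectType R) (e f : u) (phi psi : dual u).
Hypotheses (phi_e : phi e = 1) (phi_f : phi f = 0).
Hypotheses (psi_e : psi e = 0) (psi_f : psi f = 1).
Hypothesis e_f_expansion : forall v, v = phi v *: e + psi v *: f.

Definition pair_basis : 4.-tuple (u * dual u)%type :=
  [tuple (e, 0); (f, 0); (0, phi); (0, psi)].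

Lemma dual_expansion (xi : dual u) : xi = xi e *: phi + xi f *: psi.
Proof.
apply/lfunP=> v; rewrite [in LHS](e_f_expansion v) linearD !linearZ /=.
by rewrite add_lfunE !scale_lfunE /GRing.scale /= mulrC [psi v * _]mulrC.
Qed.

(** The coordinates are plain arguments, so that identities between
    endomorphisms become four scalar identities. *)
Definition of_coords (k0 k1 k2 k3 : R) : (u * dual u)%type :=
  (k0 *: e + k1 *: f, k2 *: phi + k3 *: psi).

Lemma pair_expansion (k : nat -> R) :
  \sum_(i < 4) k i *: tnth pair_basis i =
  of_coords (k 0) (k 1) (k 2) (k 3).
Proof.
rewrite !big_ord_recl big_ord0 !(tnth_nth 0).
by apply: injective_projections; rewrite /= !scaler0 !addr0 ?add0r.
Qed.

(** Each coefficient is recovered by evaluating the members of one basis on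
    those of the other. *)
Lemma pair_basis_free : free pair_basis.
Proof.
apply/freeP=> k; pose c n := k (inord n).
have kE i : k i = c i by rewrite /c inord_val.
under eq_bigr do rewrite -tnth_nth kE.
rewrite pair_expansion => -[ke kp] i.
have := congr1 phi ke; have := congr1 psi ke.
rewrite !linearD !linearZ !linear0 /= phi_e phi_f psi_e psi_f.
have := congr1 (fun xi : dual u => xi e) kp.
have := congr1 (fun xi : dual u => xi f) kp.
rewrite /= !add_lfunE !scale_lfunE !zero_lfunE phi_e phi_f psi_e psi_f.
rewrite /GRing.scale /= !mulr0 !mulr1 !addr0 !add0r => c3 c2 c1 c0.
by rewrite kE; case: i => -[|[|[|[|//]]]].
Qed.

Lemma eq_of_coords (p q : 'End((u * dual u)%type)) :
  (forall k0 k1 k2 k3,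
     p (of_coords k0 k1 k2 k3) = q (of_coords k0 k1 k2 k3)) -> p = q.
Proof.
move=> pq; apply/lfunP=> -[v xi].
by have := pq (phi v) (psi v) (xi e) (xi f);
  rewrite /of_coords -e_f_expansion -dual_expansion.
Qed.

(** This serves both structures: the symplectic type is the case a = 0,
    y = 1 / x. *)
Lemma noncomplex_mxP (J : 'End((u * dual u)%type)) (a x y : R) :
  has_matrix pair_basis J (noncomplex_mx a x y) ->
  forall k0 k1 k2 k3, J (of_coords k0 k1 k2 k3) =
    of_coords (a * k0 - x * k3) (a * k1 + x * k2)
              (- (y * k1) - a * k2) (y * k0 - a * k3).
Proof.
move=> JM k0 k1 k2 k3; pose k : nat -> R := nth 0 [:: k0; k1; k2; k3].
have -> : of_coords k0 k1 k2 k3 = \sum_(j < 4) k j *: tnth pair_basis j.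
  by rewrite pair_expansion.
pose rows := [:: [:: a; 0; 0; - x]; [:: 0; a; x; 0];
                 [:: 0; - y; - a; 0]; [:: y; 0; 0; - a]].
pose c n := \sum_(j < 4) nth 0 (nth [::] rows n) j * k j.
transitivity (\sum_(i < 4) c i *: tnth pair_basis i).
  under [RHS]eq_bigr do rewrite scaler_suml.
  rewrite exchange_big linear_sum; apply: eq_bigr => j _ /=.
  rewrite linearZ /= JM scaler_sumr; apply: eq_bigr => i _.
  by rewrite mxE scalerA mulrC.
rewrite pair_expansion /c !big_ord_recl !big_ord0 /=.
by congr of_coords; rewrite /bump /k /=; ring.
Qed.

(** The form c (phi /\ psi), contracted in its first argument. *)
Definition area_form (c : R) : 'Hom(u, dual u) :=
  linfun (fun v => c *: (phi v *: psi - psi v *: phi)).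

Lemma area_formE c v : area_form c v = c *: (phi v *: psi - psi v *: phi).
Proof.
apply: linfunE v => k v w; rewrite !linearP /=.
by apply/lfunP=> z; rewrite !lfun_simp /GRing.scale /=; ring.
Qed.

Lemma area_form_alternating c : alternating (area_form c).
Proof.
by move=> v; rewrite area_formE !lfun_simp /GRing.scale /=; ring.
Qed.

Lemma exp_area_form c k0 k1 k2 k3 :
  exp_form (area_form c) (of_coords k0 k1 k2 k3) =
  of_coords k0 k1 (k2 - c * k1) (k3 + c * k0).
Proof.
rewrite exp_formE area_formE /of_coords /=; congr pair.
rewrite !linearD !linearZ /= phi_e phi_f psi_e psi_f.
by apply/lfunP=> z; rewrite !lfun_simp /GRing.scale /=; ring.
Qed.

Lemma area_formN c : - area_form c = area_form (- c).
Proof.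
by apply/lfunP=> v; rewrite opp_lfunE !area_formE scaleNr.
Qed.

(** The multiple - a / x of the area form is forced by the coefficient of e in
    the image of e; the relation a^2 = x y - 1 makes the other entries agree. *)
Lemma noncomplex_B_transform (J : 'End((u * dual u)%type)) (a x y : R) :
  a ^+ 2 = x * y - 1 ->
  has_matrix pair_basis J (noncomplex_mx a x y) ->
  exists B : 'Hom(u, dual u),
    alternating B /\
    (exp_form (- B) \o endo_of_matrix pair_basis (symplectic_mx x)
       \o exp_form B)%VF = J.
Proof.
move=> a2 JM.
have x_neq0 : x != 0.
  apply/eqP=> x0; have := sqr_ge0 a.
  by rewrite a2 x0 mul0r sub0r oppr_ge0 ler10.
exists (area_form (- (a / x))); split; first exact: area_form_alternating.
have -> : symplectic_mx x = noncomplex_mx 0 x (1 / x).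
  by rewrite /symplectic_mx /noncomplex_mx oppr0.
have WM := noncomplex_mxP (endo_of_matrixP _ pair_basis_free).
have yE : y = (1 + a ^+ 2) / x by rewrite a2; field.
apply: eq_of_coords => k0 k1 k2 k3.
rewrite !comp_lfunE area_formN !exp_area_form WM exp_area_form.
rewrite (noncomplex_mxP JM) yE.
by congr of_coords; field.
Qed.

End DualPair.

(** * The dual pair carried by a root plane *)

Section RootPlane.
Variables (R : realType) (g : lieAlgType R[i]) (h : {vspace g}).
Variables (Hr : hdual h -> subvs_of h) (X : hdual h -> g).
Variables (H : subvs_of h) (alpha : hdual h).
Local Open Scope complex_scope.
Local Notation A := (A_alpha X alpha).
Local Notation S := (S_alpha X alpha).
Local Notation star := (star Hr H).

Lemma vsval_A : vsval A = A_vec X alpha :> g.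
Proof.
by apply: (@vsprojK _ (realification g)); rewrite memv_span ?mem_head.
Qed.

Lemma vsval_S : vsval S = S_vec X alpha :> g.
Proof.
by apply: (@vsprojK _ (realification g));
  rewrite memv_span // !in_cons eqxx orbT.
Qed.

Lemma u_alpha_span (v : u_alpha X alpha) :
  exists p q : R, v = p *: A + q *: S.
Proof.
have : vsval v \in (<[A_vec X alpha : realification g]> +
                     <<[:: S_vec X alpha : realification g]>>)%VS.
  by rewrite -span_cons; apply: subvsP.
rewrite span_seq1.
move=> /memv_addP[w /vlineP[p ->] [_ /vlineP[q ->] vE]].
exists p, q; apply: (can_inj vsvalK); rewrite vE linearP linearZ /=.
by rewrite vsval_A vsval_S.
Qed.

Lemma omega_linear (Y : g) : linear (omega H Y : g -> R[i]^o).
Proof. by move=> k Z W; rewrite /omega !linearP. Qed.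

Lemma omega_anticomm (Y Z : g) : omega H Z Y = - omega H Y Z.
Proof. by rewrite /omega lie_anticomm linearN. Qed.

Lemma starE (Y Z : u_alpha X alpha) :
  star Y Z = complex.Re (k_alpha Hr H alpha * omega H (vsval Y) (vsval Z)).
Proof.
apply: linfunE Z => r Z W; rewrite linearP.
rewrite [X in _ * X](omega_linear _ r%:C) /GRing.scale /= mulrDr mulrCA.
rewrite raddfD /=.
by congr (_ + _); case: (_ * omega _ _ _) => b c /=; rewrite mul0r subr0.
Qed.

Lemma starxx (Y : u_alpha X alpha) : star Y Y = 0.
Proof. by rewrite starE /omega liexx linear0 mulr0. Qed.

Lemma star_anticomm (Y Z : u_alpha X alpha) : star Z Y = - star Y Z.
Proof. by rewrite !starE omega_anticomm mulrN raddfN. Qed.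

Hypotheses (Hr_root : root_vectors Hr) (X_weyl : weyl_basis X).
Hypotheses (H_regular : regular H) (alpha_root : is_root alpha).

(** Moving the bracket across the form leaves H acting on the root vector
    X_alpha by the scalar alpha(H). *)
Lemma killing_bracket :
  killing (vsval H) (lie (X alpha) (X (- alpha))) = alpha H.
Proof.
have [X_root X_dual _] := X_weyl.
rewrite -killing_lieA X_root // killingC linearZ /= killingC X_dual //.
exact: mulr1.
Qed.

Lemma omega_A_S :
  omega H (A_vec X alpha) (S_vec X alpha) = 2%:R * 'i * alpha H.
Proof.
rewrite /omega /A_vec /S_vec linearZ linearD /= !lieBl !liexx sub0r subr0.
rewrite (lie_anticomm (X alpha) (X (- alpha))) opprK linearZ linearD /=.
by rewrite killing_bracket /GRing.scale /=; ring.
Qed.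

(** The constant k_alpha is the inverse of the value of omega on (A, S): by
    definition of H_alpha, <H, H_alpha> = alpha(H), and it is nonzero by
    regularity. *)
Lemma star_A_S : star A S = 1.
Proof.
rewrite starE vsval_A vsval_S omega_A_S /k_alpha killingC -Hr_root //.
rewrite mul1r mulVf //= !mulf_neq0 ?pnatr_eq0 ?neq0Ci //.
exact/eqP/H_regular.
Qed.

(** A and S span the plane by construction, and evaluating the functionals on
    A and S identifies the coefficients. *)
Lemma u_alpha_expansion (v : u_alpha X alpha) :
  v = (- star S) v *: A + star A v *: S.
Proof.
have [p [q ->]] := u_alpha_span v.
rewrite opp_lfunE !linearD !linearZ /= !starxx star_A_S star_anticomm star_A_S.
by congr (_ *: _ + _ *: _); rewrite /GRing.scale /=; ring.
Qed.

End RootPlane.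

Theorem proposition5p6
  (R : realType) (g : lieAlgType R[i]) (g_semisimple : semisimple g)
  (h : {vspace g}) (h_cartan : cartan_subalgebra h)
  (Pos : hdual h -> Prop) (Pos_positive : positive_system Pos)
  (Hr : hdual h -> subvs_of h) (Hr_root : root_vectors Hr)
  (X : hdual h -> g) (X_weyl : weyl_basis X)
  (H : subvs_of h) (H_torus : in_torus Hr H) (H_regular : regular H)
  (alpha : hdual h) (alpha_pos : Pos alpha)
  (J : 'End((u_alpha X alpha * dual (u_alpha X alpha))%type))
  (a x y : R) (J_noncomplex : noncomplex_type Hr H a x y J) :
  exists B : 'Hom(u_alpha X alpha, dual (u_alpha X alpha)),
    alternating B /\
    (exp_form (- B) \o symplectic_type Hr X H alpha x \o exp_form B)%VF = J.
Proof.
have alpha_root : is_root alpha by case: Pos_positive => + _ _ _; apply.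
have AS : star Hr H (A_alpha X alpha) (S_alpha X alpha) = 1.
  exact: star_A_S.
case: J_noncomplex => a2 JM.
apply: (@noncomplex_B_transform R _ (A_alpha X alpha) (S_alpha X alpha)
         (- star Hr H (S_alpha X alpha)) (star Hr H (A_alpha X alpha))
         _ _ _ _ _ J a x y a2 JM).
- by rewrite opp_lfunE star_anticomm AS opprK.
- by rewrite opp_lfunE starxx oppr0.
- exact: starxx.
- exact: AS.
- exact: u_alpha_expansion.
Qed.
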